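(* Let $(X,\mathcal B,m,T)$ be a probability measure preserving system and let $f:X\to U$ be bounded and measurable. Then there exists a bounded measurable $f^*:X\to U$ such that for $m$-almost every $x\in X$, $\lim_{n\to\infty}\theta_{1/n}\big(f(T^{n-1}x)\cdots f(Tx)f(x)\big)=f^*(x)$, and $f^*\circ T=f^*$ almost everywhere. If moreover $m$ is ergodic then, almost everywhere, $f^*_{i,j}=\lambda\prod_{k=i}^{j-1}\int_X f_{k,k+1}\,dm$ for all $i\le j$, where $\lambda=\lambda(j-i)>0$ is a constant depending only on $j-i$.
   Context: $U$ is the group of $d\times d$ upper triangular real matrices with all diagonal entries equal to $1$. For $t>0$, $\theta_t:U\to U$ is the automorphism defined by $(\theta_t(u))_{i,j}=t^{j-i}u_{i,j}$ for $j\ge i$. $f_{k,k+1}$ denotes the $(k,k+1)$ entry of $f$. *)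

(* Defs.v *)
From HB Require Import structures.
From mathcomp Require Import all_boot all_order all_algebra.
From mathcomp Require Import all_classical all_reals all_analysis.
Set Implicit Arguments. Unset Strict Implicit. Unset Printing Implicit Defensive.
Import Order.TTheory GRing.Theory Num.Theory.
Import numFieldNormedType.Exports.
Local Open Scope classical_set_scope.
Local Open Scope ring_scope.

Definition in_U {R : realType} {d : nat} (A : 'M[R]_d) : Prop :=
  (forall i : 'I_d, A i i = 1) /\ (forall i j : 'I_d, (j < i)%N -> A i j = 0).

(* theta_t (u)_{i,j} = t^(j-i) u_{i,j} for j >= i (and u_{i,j} for j < i,
   where u_{i,j} = 0 anyway for u in U). *)
Definition theta {R : realType} {d : nat} (t : R) (A : 'M[R]_d) : 'M[R]_d :=
  \matrix_(i, j) (if (i <= j)%N then t ^+ (j - i) * A i j else A i j).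

Fixpoint cocycle {X : Type} {R : realType} {d : nat}
  (f : X -> 'M[R]_d) (T : X -> X) (n : nat) (x : X) : 'M[R]_d :=
  match n with
  | 0 => 1%:M
  | n'.+1 => f (iter n' T x) *m cocycle f T n' x
  end.

Definition mxnat {R : realType} {d : nat} (A : 'M[R]_d) (k l : nat) : R :=
  match @insub _ (fun k => (k < d)%N) 'I_d k, @insub _ (fun k => (k < d)%N) 'I_d l with
  | Some i, Some j => A i j
  | _, _ => 0
  end.

Definition mx_measurable {disp} {X : measurableType disp} {R : realType} {d : nat}
  (f : X -> 'M[R]_d) : Prop :=
  forall i j : 'I_d, measurable_fun setT (fun x => f x i j).

Definition mx_bounded {X : Type} {R : realType} {d : nat} (f : X -> 'M[R]_d) : Prop :=
  exists M : R, forall x i j, `|f x i j| <= M.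

Definition measure_preserving {disp} {X : measurableType disp} {R : realType}
  (P : probability X R) (T : X -> X) : Prop :=
  measurable_fun setT T /\ forall A, measurable A -> P (T @^-1` A) = P A.

Definition ergodic {disp} {X : measurableType disp} {R : realType}
  (P : probability X R) (T : X -> X) : Prop :=
  forall A, measurable A -> T @^-1` A = A -> P A = 0%E \/ P A = 1%E.

(* Main.v *)
(** The [(i,j)] entry of the cocycle grows like [n ^ (j - i)]: only the products of
    superdiagonal entries contribute at this order. By induction on [j - i], the entry
    differs from ['C(n, j - i) * \prod_(i <= k < j) F k] by [o(n ^ (j - i))], where [F k]
    is the Birkhoff limit of the entry [(k, k + 1)] of [f]; binomials replace powers
    because Pascal's rule makes the recursion exact, and an Abel summation absorbs the
    fluctuations of the Birkhoff sums. Hence [lambda k = 1 / k!]. Birkhoff's theorem for a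
    bounded [f] follows from the maximal ergodic theorem applied to [f - F + e], with [F]
    the limsup of the averages, which is invariant at every point: it gives
    [\int F <= \int f], and the same for [- f] forces limsup and liminf to agree. *)
Require Import Defs.
From HB Require Import structures.
From mathcomp Require Import all_boot all_order all_algebra.
From mathcomp Require Import all_classical all_reals all_analysis.
From mathcomp Require Import measurable_realfun ring lra.
Import Order.TTheory GRing.Theory Num.Theory.
Import numFieldNormedType.Exports.
Local Open Scope classical_set_scope.
Local Open Scope ring_scope.
Set Implicit Arguments. Unset Strict Implicit. Unset Printing Implicit Defensive.

(** * Sequences negligible with respect to a power *)

Section asymptotics.
Variable R : realType.
Implicit Types (s t u : nat -> R) (p q k n : nat).

(* [s n = o(n ^ q)]; the shift keeps the denominator nonzero at [n = 0]. *)
Definition negl q s : Prop := (fun n => s n / n.+1%:R ^+ q) @ \oo --> (0 : R).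

Lemma negl0 q : negl q (fun=> 0).
Proof. by rewrite /negl; under eq_fun do rewrite mul0r; exact: cvg_cst. Qed.

Lemma neglD q s t : negl q s -> negl q t -> negl q (fun n => s n + t n).
Proof.
move=> hs ht; rewrite /negl; under eq_fun do rewrite mulrDl.
by rewrite -[0]addr0; exact: cvgD.
Qed.

Lemma neglN q s : negl q s -> negl q (fun n => - s n).
Proof.
move=> hs; rewrite /negl; under eq_fun do rewrite mulNr.
by rewrite -oppr0; exact: cvgN.
Qed.

Lemma neglZ q c s : negl q s -> negl q (fun n => c * s n).
Proof.
move=> hs; rewrite /negl; under eq_fun do rewrite -mulrA.
by rewrite -[0](mulr0 c); apply: cvgM => //; exact: cvg_cst.
Qed.

Lemma negl_sum (I : Type) (r : seq I) (P : pred I) q (s : I -> nat -> R) :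
  (forall i, P i -> negl q (s i)) -> negl q (fun n => \sum_(i <- r | P i) s i n).
Proof.
move=> hs; elim: r => [|i r ih].
  by under [X in negl _ X]eq_fun do rewrite big_nil; exact: negl0.
case Pi: (P i); under [X in negl _ X]eq_fun do rewrite big_cons Pi //.
  by apply: neglD => //; exact: hs.
exact: ih.
Qed.

Lemma negl_normP q s : negl q s <-> negl q (fun n => `|s n|).
Proof.
rewrite /negl; under [X in _ <-> (X @ _ --> _)]eq_fun => n.
  rewrite -[X in _ / X](ger0_norm (exprn_ge0 q (ler0n R n.+1))) -normf_div; over.
by split=> h; [apply/norm_cvg0P | apply/norm_cvg0P].
Qed.

Lemma negl_le q s t : (forall n, `|s n| <= t n) -> negl q t -> negl q s.
Proof.
move=> le_st ht; apply/negl_normP.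
apply: (squeeze_cvgr _ (cvg_cst (0 : R)) ht); near=> n.
by rewrite divr_ge0 ?normr_ge0 ?exprn_ge0 //= ler_pM2r ?invr_gt0 ?exprn_gt0.
Unshelve. all: by end_near. Qed.

Lemma negl_leZ q c s t : (forall n, `|s n| <= c * `|t n|) -> negl q t -> negl q s.
Proof. by move=> le_st /negl_normP/(neglZ c); exact: negl_le. Qed.

Lemma neglM p q s t : (forall n, `|t n| <= n.+1%:R ^+ q) -> negl p s ->
  negl (p + q) (fun n => s n * t n).
Proof.
move=> ht /negl_normP hs; apply/negl_normP.
apply: (squeeze_cvgr _ (cvg_cst (0 : R)) hs); near=> n.
rewrite divr_ge0 ?normr_ge0 ?exprn_ge0 //= exprD invfM mulrA normrM.
rewrite ler_pdivrMr ?exprn_gt0 // mulrAC.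
by rewrite ler_wpM2l // divr_ge0 ?exprn_ge0.
Unshelve. all: by end_near. Qed.

(** The quotient is at most [1 / n.+1], since at least one factor of the denominator survives. *)
Lemma negl_pow p q : (p < q)%N -> negl q (fun n => n.+1%:R ^+ p).
Proof.
move=> ltpq; apply: (squeeze_cvgr _ (cvg_cst (0 : R)) (@cvg_harmonic R)); near=> n.
rewrite divr_ge0 ?exprn_ge0 //= -(subnKC ltpq) addSnnS exprD invfM mulrA divff ?expf_neq0 //.
rewrite mul1r lef_pV2 ?posrE ?exprn_gt0 // -{1}[_.+1%:R]expr1.
by rewrite ler_weXn2l // ler1n.
Unshelve. all: by end_near. Qed.

(** Cesaro: the means of [|s i| / i.+1 ^ q] tend to 0, and replacing each [i.+1 ^ q] by the larger
    [n.+1 ^ q] only decreases them. Summation thus costs exactly one power of [n]. *)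
Lemma negl_series q s : negl q s -> negl q.+1 (series s).
Proof.
move=> /negl_normP hs.
have /cesaro hc := hs.
apply/negl_normP; apply: (squeeze_cvgr _ (cvg_cst (0 : R)) hc); near=> n.
rewrite divr_ge0 ?normr_ge0 ?exprn_ge0 //= /arithmetic_mean /= exprS invfM mulrA mulrAC.
rewrite mulrC ler_pM2l ?invr_gt0 // ler_pdivrMr ?exprn_gt0 //.
rewrite /series /= (le_trans (ler_norm_sum _ _ _)) // big_nat_recr //= mulrDl.
rewrite ler_wpDr ?mulr_ge0 ?divr_ge0 ?exprn_ge0 // mulr_suml.
rewrite !big_nat ler_sum // => i /andP[_ lein].
rewrite -mulrA ler_peMr // mulrC ler_pdivlMr ?exprn_gt0 // mul1r.
by rewrite lerXn2r ?nnegrE // ler_nat ltnS ltnW.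
Unshelve. all: by end_near. Qed.

(** Since [n.+2 <= 2 * n.+1], changing the denominator costs at most the constant [2 ^+ q]. *)
Lemma negl_shift q s : negl q s -> negl q (fun n => s n.+1).
Proof.
move=> /negl_normP; rewrite /negl -(cvg_shiftS (fun n => `|s n| / n.+1%:R ^+ q)).
move=> hs; apply/negl_normP.
have {}hs : (fun n => 2 ^+ q * (`|s n.+1| / n.+2%:R ^+ q)) @ \oo --> (0 : R).
  by rewrite -[0](mulr0 (2 ^+ q)); apply: cvgM => //; exact: cvg_cst.
apply: (squeeze_cvgr _ (cvg_cst (0 : R)) hs); near=> n.
rewrite divr_ge0 ?normr_ge0 ?exprn_ge0 //= mulrCA ler_wpM2l //.
rewrite ler_pdivlMr ?exprn_gt0 // mulrC ler_pdivrMr ?exprn_gt0 // -exprMn.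
by rewrite lerXn2r ?nnegrE // -natrM ler_nat mul2n -addnn !addSn !addnS !ltnS leq_addr.
Unshelve. all: by end_near. Qed.

Lemma bin_le_expn n k : ('C(n, k) <= n.+1 ^ k)%N.
Proof.
elim: k => [|k ih]; first by rewrite bin0.
apply: (@leq_trans (k.+1 * 'C(n, k.+1))); first by rewrite leq_pmull.
by rewrite mul_bin_left expnS leq_mul // (leq_trans (leq_subr _ _)).
Qed.

Lemma norm_bin_le n k : `|'C(n, k)%:R : R| <= n.+1%:R ^+ k.
Proof. by rewrite normr_nat -natrX ler_nat bin_le_expn. Qed.

(** Induction through [k.+1 * 'C(n, k.+1) = (n - k) * 'C(n, k)]: the new factor [(n - k) / n.+1]
    equals [1 - k.+1 / n.+1] and tends to 1. *)
Lemma cvg_bin k :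
  (fun n => 'C(n, k)%:R / n.+1%:R ^+ k) @ \oo --> (k`!%:R^-1 : R).
Proof.
elim: k => [|k ih].
  by under eq_fun do rewrite bin0 expr0 divr1; rewrite fact0 invr1; exact: cvg_cst.
have h : (fun n => k.+1%:R^-1 * (1 - k.+1%:R * harmonic n) * ('C(n, k)%:R / n.+1%:R ^+ k))
    @ \oo --> (k.+1%:R^-1 * (1 - k.+1%:R * 0) * k`!%:R^-1 : R).
  apply: cvgM ih; apply: cvgM; first exact: cvg_cst.
  apply: cvgB; first exact: cvg_cst.
  by apply: cvgM; [exact: cvg_cst | exact: cvg_harmonic].
move: h; rewrite mulr0 subr0 mulr1 -invfM -natrM -factS; apply: cvg_trans.
apply: near_eq_cvg; near=> n.
have lekn : (k <= n)%N by near: n; exact: nbhs_infty_ge.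
have e : k.+1%:R * 'C(n, k.+1)%:R = (n%:R - k%:R) * 'C(n, k)%:R :> R.
  by rewrite -natrB // -!natrM mul_bin_left.
have e' : 'C(n, k.+1)%:R = k.+1%:R^-1 * ((n%:R - k%:R) * 'C(n, k)%:R) :> R.
  by rewrite -e mulKf.
rewrite e' /= exprS invfM.
have -> : 1 - k.+1%:R / n.+1%:R = (n%:R - k%:R) / n.+1%:R :> R.
  by field; apply: lt0r_neq0; move: (ler0n R n); lra.
by rewrite -!mulrA [n.+1%:R^-1 * _]mulrCA.
Unshelve. all: by end_near. Qed.

Lemma negl_bin p q : (p < q)%N -> negl q (fun n => 'C(n, p)%:R).
Proof. by move=> ltpq; apply: negl_le (negl_pow ltpq) => n; exact: norm_bin_le. Qed.

(** The terms [s m] may stay of order 1, so [negl_series] does not apply; only their partial sums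
    are small. Abel summation moves the difference onto the binomial, where Pascal's rule lowers [q]
    by one. *)
Lemma negl_series_bin q s : negl 1 (series s) ->
  negl q.+1 (series (fun m => s m * 'C(m, q)%:R)).
Proof.
move=> hs; case: q => [|q].
  by rewrite (_ : (fun m => _) = s) //; apply/funext => m; rewrite bin0 mulr1.
have abel n : series (fun m => s m * 'C(m, q.+1)%:R) n =
    series s n * 'C(n, q.+1)%:R - series (fun m => series s m.+1 * 'C(m, q)%:R) n.
  elim: n => [|n ih]; first by rewrite /series /= !big_geq // mul0r subr0.
  by rewrite !seriesSr ih binS natrD; ring.
rewrite (funext abel); apply: neglD.
  by rewrite -add1n; apply: neglM => // n; exact: norm_bin_le.
apply: neglN; apply: negl_series; rewrite -add1n; apply: neglM.
  by move=> n; exact: norm_bin_le.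
exact: negl_shift.
Qed.

(** Passes from the normalisation by [n.+1] to that by [n]: the ratio [(1 + 1 / n) ^ k] tends to 1.
    The default value of the inverse at [n = 0] is discarded by working near infinity. *)
Lemma cvg_unshift k s (l : R) : (fun n => s n / n.+1%:R ^+ k) @ \oo --> l ->
  (fun n => n%:R^-1 ^+ k * s n) @ \oo --> l.
Proof.
move=> hs.
have h1 : (fun n => 1 + (n%:R : R)^-1) @ \oo --> (1 + 0 : R).
  apply: cvgD; first exact: cvg_cst.
  rewrite -(cvg_shiftS (fun n => (n%:R : R)^-1)); exact: cvg_harmonic.
have h2 : (fun n => (1 + (n%:R : R)^-1) ^+ k) @ \oo --> ((1 + 0) ^+ k : R).
  elim: k {hs} => [|k ih].
    by rewrite expr0; exact: cvg_cst.
  by under eq_fun do rewrite exprS; rewrite exprS; exact: (cvgM h1 ih).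
rewrite addr0 expr1n in h2.
have h : (fun n => (1 + (n%:R : R)^-1) ^+ k * (s n / n.+1%:R ^+ k)) @ \oo --> l.
  by rewrite -[l]mul1r; exact: cvgM.
move: h; apply: cvg_trans.
apply: near_eq_cvg; near=> n.
have n0 : (0 < n)%N by near: n; exact: nbhs_infty_gt.
have n0' : n%:R != 0 :> R by rewrite pnatr_eq0 -lt0n.
rewrite /= mulrCA mulrC -expr_div_n; congr (_ ^+ _ * _).
have : n.+1%:R != 0 :> R by [].
by rewrite -natr1 => n1; field; rewrite n0' n1.
Unshelve. all: by end_near. Qed.

Lemma negl_weaken p q s : (p <= q)%N -> negl p s -> negl q s.
Proof.
move=> pq /negl_normP hs; apply/negl_normP.
apply: (squeeze_cvgr _ (cvg_cst (0 : R)) hs); near=> n.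
rewrite divr_ge0 ?exprn_ge0 //= ler_wpM2l // lef_pV2 ?posrE ?exprn_gt0 //.
by rewrite ler_weXn2l // ler1n.
Unshelve. all: by end_near. Qed.

(** Puts the conclusion of the ergodic theorem in the form that [negl_series_bin] consumes.
    [arithmetic_mean s n] averages [n.+1] terms, hence the shift of the index. *)
Lemma negl_series_mean s (l : R) : arithmetic_mean s @ \oo --> l ->
  negl 1 (series (fun m => s m - l)).
Proof.
move=> hs; apply/negl_normP.
rewrite /negl -(cvg_shiftS (fun n => `|series (fun m => s m - l) n| / n.+1%:R ^+ 1)).
have h : (fun n => `|arithmetic_mean s n - l|) @ \oo --> (0 : R).
  by apply/norm_cvg0P; apply/subr_cvg0.
apply: (squeeze_cvgr _ (cvg_cst (0 : R)) h); near=> n.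
rewrite divr_ge0 ?exprn_ge0 //= expr1.
have -> : series (fun m => s m - l) n.+1 = n.+1%:R * (arithmetic_mean s n - l).
  rewrite mulrBr /arithmetic_mean /= mulVKf // /series /= big_split /= sumrN.
  by rewrite big_const_nat subn0 iter_addr_0 mulr_natl.
rewrite normrM ger0_norm // mulrAC ler_piMl // ler_pdivrMr // mul1r.
by rewrite ler_nat.
Unshelve. all: by end_near. Qed.

End asymptotics.


(** * Limsup of bounded real sequences *)

Section limsup.
Variable R : realType.
Implicit Types (u v : nat -> R) (M : R).

Lemma le_norm_bounded_fun (I : Type) (w : I -> R) M :
  (forall i, `|w i| <= M) -> bounded_fun (w : I -> R^o).
Proof.
by move=> h; exists M; split; [exact: num_real | move=> r /ltW Mr i _; exact: le_trans (h i) _].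
Qed.

Lemma cvg_sups_bounded u M : (forall n, `|u n| <= M) -> sups u @ \oo --> limn_sup u.
Proof.
move=> /le_norm_bounded_fun ub; rewrite limn_supE //; apply: cvg_sups_inf.
  exact: bounded_fun_has_ubound.
exact: bounded_fun_has_lbound.
Qed.

Lemma le_sups u M n : (forall n, `|u n| <= M) -> u n <= sups u n.
Proof.
move=> uM; apply: ub_le_sup; last by exists n => /=.
by exists M => _ [k _ <-]; exact: le_trans (ler_norm _) (uM k).
Qed.

Lemma sups_leP u c n : (forall k, (n <= k)%N -> u k <= c) -> sups u n <= c.
Proof.
move=> uc; apply: ge_sup; first by exists (u n); exists n => /=.
by move=> _ [k /= nk <-]; exact: uc.
Qed.

Lemma limn_sup_le u M c : (forall n, `|u n| <= M) ->
  (forall n, u n <= c) -> limn_sup u <= c.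
Proof.
move=> uM uc; apply: (cvgr_to_le (cvg_sups_bounded uM)).
by apply: nearW => n; exact: sups_leP.
Qed.

Lemma limn_sup_norm u M : (forall n, `|u n| <= M) -> `|limn_sup u| <= M.
Proof.
move=> uM; rewrite ler_norml; apply/andP; split; last first.
  by apply: (limn_sup_le uM) => n; exact: le_trans (ler_norm _) (uM n).
apply: (cvgr_to_ge (cvg_sups_bounded uM)); apply: nearW => n.
by apply: le_trans (le_sups n uM); move: (uM n); rewrite ler_norml => /andP[].
Qed.

Lemma limn_sup_lt u M e : (forall n, `|u n| <= M) -> 0 < e ->
  exists n, limn_sup u - e < u n.
Proof.
move=> uM e0; apply/not_existsP => h.
have : limn_sup u <= limn_sup u - e.
  by apply: (limn_sup_le uM) => n; rewrite leNgt; apply/negP/h.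
by lra.
Qed.

(** Subadditivity of the limsup for [u = v + (u - v)]. *)
Lemma limn_sup_le_eq u v M : (forall n, `|u n| <= M) -> (forall n, `|v n| <= M) ->
  (fun n => u n - v n) @ \oo --> (0 : R) -> limn_sup u <= limn_sup v.
Proof.
move=> uM vM uv.
have hv := le_norm_bounded_fun vM; have hu := le_norm_bounded_fun uM.
have huv : bounded_fun (fun n => u n - v n : R^o).
  by apply: (@le_norm_bounded_fun _ _ (M + M)) => n; rewrite (le_trans (ler_normB _ _)) ?lerD.
have := le_limn_supD hv huv.
have -> : (v \+ (fun n => u n - v n)) = u by apply/funext => n /=; rewrite addrC subrK.
by rewrite (cvg_limn_inf_sup uv).2 addr0.
Qed.

Lemma limn_sup_eq u v M : (forall n, `|u n| <= M) -> (forall n, `|v n| <= M) ->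
  (fun n => u n - v n) @ \oo --> (0 : R) -> limn_sup u = limn_sup v.
Proof.
move=> uM vM uv; apply/eqP; rewrite eq_le (limn_sup_le_eq uM vM uv) /=.
apply: (limn_sup_le_eq vM uM); under eq_fun do rewrite -opprB.
by rewrite -oppr0; exact: cvgN.
Qed.

(** This is liminf [<=] limsup: the liminf is written as minus the limsup of [- u], so that one
    operator serves for both. *)
Lemma limn_sup_ge_oppN u M : (forall n, `|u n| <= M) ->
  - limn_sup (fun n => - u n) <= limn_sup u.
Proof.
move=> uM; have uM' n : `|- u n| <= M by rewrite normrN.
have h : (fun n => sups u n + sups (fun n => - u n) n) @ \oo -->
    (limn_sup u + limn_sup (fun n => - u n) : R).
  exact: (cvgD (cvg_sups_bounded uM) (cvg_sups_bounded uM')).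
rewrite -subr_ge0 opprK; apply: (cvgr_to_ge h); apply: nearW => n.
by have := le_sups n uM; have := le_sups n uM'; lra.
Qed.

(** The sequence is squeezed between the tail infima [- sups (- u)] and the tail suprema [sups u],
    which share their limit. *)
Lemma cvg_limn_sup u M : (forall n, `|u n| <= M) ->
  limn_sup u <= - limn_sup (fun n => - u n) -> u @ \oo --> limn_sup u.
Proof.
move=> uM le; have uM' n : `|- u n| <= M by rewrite normrN.
have e : limn_sup u = - limn_sup (fun n => - u n).
  by apply/eqP; rewrite eq_le le (limn_sup_ge_oppN uM).
have h : (fun n => - sups (fun n => - u n) n) @ \oo --> (limn_sup u : R).
  by rewrite e; apply: cvgN; exact: cvg_sups_bounded uM'.
apply: (squeeze_cvgr _ h (cvg_sups_bounded uM)); near=> n.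
by rewrite (le_sups n uM) andbT lerNl (le_sups n uM').
Unshelve. all: by end_near. Qed.

End limsup.

(** * Pointwise ergodic theorem for bounded functions *)

Section birkhoff.
Context {disp : measure_display} {X : measurableType disp} {R : realType}.
Variables (P : probability X R) (T : X -> X).
Hypothesis mpT : measure_preserving P T.
Implicit Types f g : X -> R.

(** A class stable under all the operations below and contained in the integrable functions, so that
    integrability is never a separate argument. *)
Definition bdd_meas f : Prop :=
  measurable_fun setT f /\ exists M : R, forall x, `|f x| <= M.

Lemma bdd_meas_integrable f : bdd_meas f -> P.-integrable setT (EFin \o f).
Proof.
move=> [mf [M fM]]; apply: measurable_bounded_integrable => //.
  exact: le_lt_trans (probability_le1 P measurableT) (ltry _).
exact: le_norm_bounded_fun fM.
Qed.

Lemma bdd_meas_cst c : bdd_meas (fun=> c).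
Proof. by split; [exact: measurable_cst | exists `|c|]. Qed.

Lemma bdd_measN f : bdd_meas f -> bdd_meas (fun x => - f x).
Proof.
by move=> [mf [M fM]]; split; [exact: measurableT_comp | exists M => x; rewrite normrN].
Qed.

Lemma bdd_measD f g : bdd_meas f -> bdd_meas g -> bdd_meas (fun x => f x + g x).
Proof.
move=> [mf [M fM]] [mg [M' gM]]; split; first exact: measurable_funD.
by exists (M + M') => x; rewrite (le_trans (ler_normD _ _)) ?lerD.
Qed.

Lemma bdd_measM f g : bdd_meas f -> bdd_meas g -> bdd_meas (fun x => f x * g x).
Proof.
move=> [mf [M fM]] [mg [M' gM]]; split; first exact: measurable_funM.
by exists (M * M') => x; rewrite normrM ler_pM.
Qed.

Lemma bdd_meas_max0 f : bdd_meas f -> bdd_meas (fun x => Num.max 0 (f x)).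
Proof.
move=> [mf [M fM]]; split.
  by apply: measurable_maxr => //; exact: measurable_cst.
by exists M => x; have := fM x; rewrite maxElt; case: ifP => // _; rewrite normr0; exact: le_trans.
Qed.

Lemma bdd_meas_comp f : bdd_meas f -> bdd_meas (fun x => f (T x)).
Proof.
by move=> [mf [M fM]]; split; [exact: measurableT_comp mpT.1 | exists M].
Qed.

Lemma bdd_meas_indic (A : set X) : measurable A -> bdd_meas (\1_A).
Proof.
move=> mA; split; first exact: measurable_indic.
by exists 1 => x; rewrite indicE; case: (_ \in _); rewrite ?normr1 ?normr0.
Qed.

Lemma Rintegral_cst1 (c : R) : \int[P]_x c = c.
Proof.
rewrite Rintegral_cst // [X in fine X](_ : _ = 1%E) ?mulr1 //.
exact: probability_setT.
Qed.

(** Change of variables: the image of [P] under [T] is [P]. *)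
Lemma Rintegral_comp f : bdd_meas f -> \int[P]_x f (T x) = \int[P]_x f x.
Proof.
move=> bf; have [mf _] := bf; rewrite /Rintegral; congr fine.
have mT := mpT.1.
rewrite -(@integral_pushforward _ _ _ _ _ _ mT P setT (EFin \o f)) //.
- by apply: eq_measure_integral => A mA _; exact: (mpT.2 A mA).
- exact: measurableT_comp.
- by rewrite preimage_setT; exact: bdd_meas_integrable (bdd_meas_comp bf).
Qed.

(* [maxsum f N x] is the maximum over [0 <= n <= N] of the partial orbit sums. *)
Fixpoint maxsum f (N : nat) (x : X) : R :=
  if N is N'.+1 then Num.max 0 (f x + maxsum f N' (T x)) else 0.

Definition along_orbit f (x : X) (n : nat) : R := f (iter n T x).

Lemma orbit_sumS f x n :
  series (along_orbit f x) n.+1 = f x + series (along_orbit f (T x)) n.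
Proof.
rewrite /series /= big_nat_recl //=; congr (_ + _).
by apply: eq_bigr => i _; rewrite /along_orbit iterSr.
Qed.

Lemma bdd_meas_maxsum f N : bdd_meas f -> bdd_meas (maxsum f N).
Proof.
move=> bf; elim: N => [|N ih]; first exact: bdd_meas_cst.
by apply: bdd_meas_max0; apply: bdd_measD => //; exact: bdd_meas_comp.
Qed.

Lemma maxsum_ge0 f N x : 0 <= maxsum f N x.
Proof. by case: N => [|N] //=; rewrite le_max lexx. Qed.

Lemma maxsum_leS f N x : maxsum f N x <= maxsum f N.+1 x.
Proof.
elim: N x => [|N ih] x; first exact: maxsum_ge0.
rewrite [X in _ <= X]/= [X in X <= _]/= ge_max !le_max lexx /=.
by rewrite lerD2l (ih (T x)) orbT.
Qed.

Lemma le_maxsum f n N x : (n <= N)%N -> series (along_orbit f x) n <= maxsum f N x.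
Proof.
elim: N n x => [|N ih] [|n] x //; rewrite ?[series _ 0]/series /= ?big_geq //.
  by rewrite le_max lexx.
by move=> nN; rewrite orbit_sumS le_max lerD2l ih ?orbT.
Qed.

(** Where [maxsum f N] is positive, it equals [f x] plus the maximum over one step fewer at [T x],
    which is at most [maxsum f N (T x)]. Elsewhere it vanishes and the left side is nonpositive. *)
Lemma maxsum_sub_le f N x :
  maxsum f N x - maxsum f N (T x) <= f x * \1_[set y | 0 < maxsum f N y] x.
Proof.
rewrite indicE; case: (boolP (_ \in _)) => [/set_mem /= h|/negP h]; last first.
  rewrite mulr0 subr_le0; apply: le_trans (maxsum_ge0 f N (T x)).
  by rewrite leNgt; apply/negP => h'; apply: h; rewrite inE.
rewrite mulr1; case: N h => [|N]; first by rewrite /= ltxx.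
rewrite [maxsum _ _.+1 x]/= lt_max ltxx /= => h.
by rewrite max_r ?(ltW h) // lerBlDr lerD2l maxsum_leS.
Qed.

Lemma measurable_maxsum_gt0 f N : bdd_meas f ->
  measurable [set y | 0 < maxsum f N y].
Proof.
move=> bf; have [mf _] := bdd_meas_maxsum N bf.
have := measurable_fun_ltr (measurable_cst (0 : R)) mf.
by move=> /(_ measurableT [set true]); rewrite setTI; exact.
Qed.

(* Maximal ergodic theorem (Garsia's proof). *)
Lemma Rintegral_maxsum_ge0 f N : bdd_meas f ->
  0 <= \int[P]_x (f x * \1_[set y | 0 < maxsum f N y] x).
Proof.
move=> bf; have bM := bdd_meas_maxsum N bf; have bMT := bdd_meas_comp bM.
(* The left side of [maxsum_sub_le] is a coboundary, so its integral is zero. *)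
have h0 : \int[P]_x (maxsum f N x - maxsum f N (T x)) = 0.
  by rewrite RintegralB ?Rintegral_comp ?subrr //; exact: bdd_meas_integrable.
rewrite -[X in X <= _]h0; apply: le_Rintegral => //.
- exact: (bdd_meas_integrable (bdd_measD bM (bdd_measN bMT))).
- apply: bdd_meas_integrable; apply: bdd_measM => //; apply: bdd_meas_indic.
  exact: (measurable_maxsum_gt0 N bf).
- by move=> x _; exact: maxsum_sub_le.
Qed.

(** The sets where [maxsum f N] is positive exhaust [X] as [N] grows, so dominated convergence
    removes the indicator from the maximal inequality. *)
Lemma Rintegral_ge0_of_sums f : bdd_meas f ->
  (forall x, exists n, 0 < series (along_orbit f x) n) -> 0 <= \int[P]_x f x.
Proof.
move=> bf hf.
pose h N := fun x => f x * \1_[set y | 0 < maxsum f N y] x.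
have bh N : bdd_meas (h N).
  by apply: bdd_measM => //; apply: bdd_meas_indic; exact: (measurable_maxsum_gt0 N bf).
have [mf [M fM]] := bf.
have [] := @dominated_convergence _ _ _ P setT measurableT
  (fun N => EFin \o h N) (EFin \o f) (cst M%:E).
- by move=> N; apply: measurableT_comp => //; exact: (bh N).1.
- exact: measurableT_comp.
- apply: aeW => x _.
  have [n hn] := hf x.
  (* Once [N] reaches a time [n] with positive orbit sum, the indicator at [x] is 1 for good. *)
  apply: cvg_near_cst; near=> N.
  have nN : (n <= N)%N by near: N; exact: nbhs_infty_ge.
  by rewrite /h /= indicE mem_set ?mulr1 //= (lt_le_trans hn) // le_maxsum.
- exact: (bdd_meas_integrable (bdd_meas_cst M)).
- apply: aeW => x N _; rewrite /h /= lee_fin normrM -[X in _ <= X]mulr1.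
  by rewrite ler_pM // indicE; case: (_ \in _); rewrite ?normr1 ?normr0.
move=> _ _ hcvg; rewrite /Rintegral fine_ge0 // -(cvg_lim _ hcvg) //.
apply: lime_ge; first by apply/cvg_ex; eexists; exact: hcvg.
apply: nearW => N /=.
have := Rintegral_maxsum_ge0 N bf; rewrite /Rintegral -lee_fin fineK //.
by apply: integrable_fin_num => //; exact: (bdd_meas_integrable (bh N)).
Unshelve. all: by end_near. Qed.

Lemma ae_eq0_of_Rintegral f : bdd_meas f -> {ae P, forall x, 0 <= f x} ->
  \int[P]_x f x <= 0 -> {ae P, forall x, f x = 0}.
Proof.
move=> bf f0 If.
have mf : measurable_fun setT (EFin \o f) by apply: measurableT_comp => //; exact: bf.1.
have e : (\int[P]_x `|(EFin \o f) x| = \int[P]_x (EFin \o f) x)%E.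
  apply: ae_eq_integral => //.
    by apply: measurableT_comp mf; exact: abse_measurable.
  by apply: filterS f0 => x fx _ /=; rewrite ger0_norm.
have /(ae_eq_integral_abs P measurableT mf) : (\int[P]_x `|(EFin \o f) x|)%E = 0%E.
  apply/eqP; rewrite eq_le integral_ge0 // andbT e.
  by rewrite -lee_fin /Rintegral fineK // in If;
    apply: integrable_fin_num => //; exact: bdd_meas_integrable.
by apply: filterS => x /(_ I) /= [].
Qed.

Definition mean f x : nat -> R := arithmetic_mean (along_orbit f x).

(** Taking the limsup gives a function defined, bounded and invariant at every point; it is
    identified as an almost sure limit only in [birkhoff_cvg]. *)
Definition birkhoff f x : R := limn_sup (mean f x).

Lemma mean_norm_le f M x : (forall y, `|f y| <= M) -> forall n, `|mean f x n| <= M.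
Proof.
move=> fM n; rewrite /mean /arithmetic_mean /= normrM ger0_norm ?invr_ge0 //.
rewrite mulrC ler_pdivrMr // (le_trans (ler_norm_sum _ _ _)) //.
apply: (@le_trans _ _ (\sum_(0 <= i < n.+1) M)); first by apply: ler_sum => i _; exact: fM.
by rewrite big_const_nat subn0 iter_addr_0 mulr_natr.
Qed.

Lemma measurable_mean f n : measurable_fun setT f -> measurable_fun setT (mean f ^~ n).
Proof.
move=> mf; apply: measurable_funM; first exact: measurable_cst.
rewrite /series /=; apply: measurable_sum => i; apply: measurableT_comp => //.
elim: i => [|i ih]; first exact: measurable_id.
exact: measurableT_comp mpT.1 ih.
Qed.

Lemma birkhoff_norm_le f M : (forall y, `|f y| <= M) -> forall x, `|birkhoff f x| <= M.
Proof. by move=> fM x; apply: limn_sup_norm; exact: mean_norm_le. Qed.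

Lemma bdd_meas_birkhoff f : bdd_meas f -> bdd_meas (birkhoff f).
Proof.
move=> [mf [M fM]]; split; last by exists M; exact: birkhoff_norm_le.
apply: measurable_fun_limn_sup => [x _|x _|n]; last exact: measurable_mean.
  exact: bounded_fun_has_ubound (le_norm_bounded_fun (mean_norm_le x fM)).
exact: bounded_fun_has_lbound (le_norm_bounded_fun (mean_norm_le x fM)).
Qed.

(** The orbit sums at [x] and [T x] telescope to two boundary terms, so the means differ by
    [O(1 / n)]. *)
Lemma birkhoff_invariant f x : bdd_meas f -> birkhoff f (T x) = birkhoff f x.
Proof.
move=> [mf [M fM]]; apply: (limn_sup_eq (mean_norm_le _ fM) (mean_norm_le _ fM)).
have h : (fun n => (M + M) * harmonic n) @ \oo --> (0 : R).
  rewrite -[0](mulr0 (M + M)); apply: cvgM; first exact: cvg_cst.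
  exact: cvg_harmonic.
apply/norm_cvg0P; apply: (squeeze_cvgr _ (cvg_cst (0 : R)) h); near=> n.
rewrite normr_ge0 /= /mean /arithmetic_mean /= -mulrBr.
have -> : series (along_orbit f (T x)) n.+1 - series (along_orbit f x) n.+1 =
    f (iter n.+1 T x) - f x.
  rewrite [series (along_orbit f x) _]orbit_sumS seriesSr.
  by rewrite [along_orbit f (T x) n](_ : _ = f (iter n.+1 T x)) /along_orbit ?iterSr //; lra.
rewrite normrM ger0_norm ?invr_ge0 // mulrC ler_pM2r ?invr_gt0 //.
by rewrite (le_trans (ler_normB _ _)) ?lerD.
Unshelve. all: by end_near. Qed.

Lemma birkhoff_iter f n x : bdd_meas f -> birkhoff f (iter n T x) = birkhoff f x.
Proof. by move=> bf; elim: n => //= n ih; rewrite birkhoff_invariant. Qed.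

(* [f - birkhoff f + e] has a positive orbit sum at every point. *)
Lemma Rintegral_birkhoff_le f : bdd_meas f -> \int[P]_x birkhoff f x <= \int[P]_x f x.
Proof.
move=> bf; have bF := bdd_meas_birkhoff bf; have [mf [M fM]] := bf.
apply/ler_addgt0Pr => e e0.
have bFe := bdd_measD (bdd_measN bF) (bdd_meas_cst e).
have : 0 <= \int[P]_x (f x + (- birkhoff f x + e)).
  apply: Rintegral_ge0_of_sums; first exact: bdd_measD.
  move=> x; have [n hn] := limn_sup_lt (mean_norm_le x fM) e0; exists n.+1.
  (* As [birkhoff f] is constant along the orbit, the sum is a multiple of the gap between the mean
     and the limsup less [e]; [mean f x n] covers [n.+1] terms. *)
  have -> : series (along_orbit (fun x => f x + (- birkhoff f x + e)) x) n.+1 =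
      n.+1%:R * (mean f x n - (birkhoff f x - e)).
    rewrite mulrBr /mean /arithmetic_mean /= mulVKf // /series /= /along_orbit big_split /=.
    congr (_ + _).
    under eq_bigr do rewrite birkhoff_iter //.
    by rewrite big_const_nat subn0 iter_addr_0 -mulr_natl; ring.
  by rewrite mulr_gt0 // subr_gt0.
rewrite RintegralD //; try exact: bdd_meas_integrable.
have -> : \int[P]_x (- birkhoff f x + e) = \int[P]_x (e - birkhoff f x).
  by apply: eq_Rintegral => x _; rewrite addrC.
rewrite RintegralB //; try exact: bdd_meas_integrable;
    last exact: (bdd_meas_integrable (bdd_meas_cst e)).
by rewrite Rintegral_cst1; lra.
Qed.

Lemma meanN f x : mean (fun y => - f y) x = fun n => - mean f x n.
Proof.
apply/funext => n; rewrite /mean /arithmetic_mean /= -mulrN; congr (_ * _).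
by rewrite /series /= /orbit sumrN.
Qed.

Lemma birkhoffN f x : bdd_meas f -> - birkhoff (fun y => - f y) x <= birkhoff f x.
Proof.
by move=> [_ [M fM]]; rewrite /birkhoff meanN; exact: limn_sup_ge_oppN (mean_norm_le x fM).
Qed.

Lemma RintegralN f : bdd_meas f -> \int[P]_x (- f x) = - \int[P]_x f x.
Proof.
move=> bf; rewrite -mulN1r -RintegralZl //; last exact: bdd_meas_integrable.
by apply: eq_Rintegral => x _; rewrite mulN1r.
Qed.

(** The inequality for [- f] bounds the integral of [f] by that of the liminf, hence by that of the
    limsup. *)
Lemma Rintegral_birkhoff f : bdd_meas f -> \int[P]_x birkhoff f x = \int[P]_x f x.
Proof.
move=> bf; apply/eqP; rewrite eq_le Rintegral_birkhoff_le //=.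
have bN := bdd_measN bf; have := Rintegral_birkhoff_le bN; rewrite RintegralN // => h.
have : \int[P]_x (- birkhoff (fun y => - f y) x) <= \int[P]_x birkhoff f x.
  apply: le_Rintegral => //; last by move=> x _; exact: birkhoffN.
    exact: (bdd_meas_integrable (bdd_measN (bdd_meas_birkhoff bN))).
  exact: (bdd_meas_integrable (bdd_meas_birkhoff bf)).
by rewrite RintegralN; [lra | exact: bdd_meas_birkhoff].
Qed.

(** Limsup minus liminf is nonnegative with integral zero, hence null almost everywhere. *)
Lemma birkhoff_cvg f : bdd_meas f -> {ae P, forall x, mean f x @ \oo --> birkhoff f x}.
Proof.
move=> bf; have [_ [M fM]] := bf; have bN := bdd_measN bf.
have bF := bdd_meas_birkhoff bf; have bFN := bdd_meas_birkhoff bN.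
have : {ae P, forall x, birkhoff f x + birkhoff (fun y => - f y) x = 0}.
  apply: (ae_eq0_of_Rintegral (bdd_measD bF bFN)).
    by apply: aeW => x; have := birkhoffN x bf; lra.
  rewrite RintegralD //; try exact: bdd_meas_integrable.
  by rewrite !Rintegral_birkhoff // RintegralN // subrr.
apply: filterS => x h; apply: (cvg_limn_sup (mean_norm_le x fM)).
rewrite -meanN -/(birkhoff f x) -/(birkhoff (fun y => - f y) x); lra.
Qed.

(** The set where [birkhoff f] exceeds its mean [c] is exactly invariant, as [ergodic] demands.
    Having measure 0 or 1, it fixes the sign of [birkhoff f - c] almost everywhere, and a function
    of constant sign and zero integral vanishes. *)
Lemma birkhoff_ergodic f : ergodic P T -> bdd_meas f ->
  {ae P, forall x, birkhoff f x = \int[P]_y f y}.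
Proof.
move=> ergT bf; have bF := bdd_meas_birkhoff bf.
set c := \int[P]_y f y.
have bc := bdd_meas_cst (- c).
have key (s : R) : \int[P]_x (s * (birkhoff f x - c)) = 0.
  rewrite RintegralZl //; last exact: (bdd_meas_integrable (bdd_measD bF bc)).
  rewrite RintegralB //; try exact: bdd_meas_integrable;
    last exact: (bdd_meas_integrable (bdd_meas_cst c)).
  by rewrite Rintegral_birkhoff // Rintegral_cst1 subrr mulr0.
pose A := [set x | c < birkhoff f x].
have mA : measurable A.
  have := measurable_fun_ltr (measurable_cst c) bF.1.
  by move=> /(_ measurableT [set true]); rewrite setTI; exact.
have TA : T @^-1` A = A.
  by apply/seteqP; split => x /=; rewrite /A /= birkhoff_invariant.
(* The scalar [s] is that sign: [-1] if the set is null, [1] if it has full measure. *)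
suff [s s0 hs] : exists2 s : R, s != 0 & {ae P, forall x, 0 <= s * (birkhoff f x - c)}.
  have := ae_eq0_of_Rintegral (bdd_measM (bdd_meas_cst s) (bdd_measD bF bc)) hs.
  rewrite key => /(_ (lexx _)); apply: filterS => x /eqP.
  by rewrite mulf_eq0 (negPf s0) /= subr_eq0 => /eqP.
have [PA|PA] := ergT A mA TA.
  exists (-1); first by rewrite oppr_eq0 oner_eq0.
  exists A; split => // x /= h; rewrite /A /= ltNge; apply/negP => h'; apply: h; lra.
exists 1; first exact: oner_neq0.
exists (~` A); split => //; first exact: measurableC.
  by rewrite probability_setC // PA subee.
by move=> x /= h h'; apply: h; rewrite /A /= in h'; lra.
Qed.

End birkhoff.

(** A neighbourhood of a matrix contains a product of entrywise neighbourhoods, and there are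
    finitely many entries. *)
Lemma cvg_mx_entries (R : realType) (d : nat) (A : nat -> 'M[R]_d) (B : 'M[R]_d) :
  (forall i j, (fun n => A n i j) @ \oo --> B i j) -> A @ \oo --> B.
Proof.
move=> h V [Q nQ QV].
have : \forall n \near \oo, forall i j, Q i j (A n i j).
  by apply: filter_forall => i; apply: filter_forall => j; apply: h; exact: nQ.
by apply: filterS => n hn; exact: QV.
Qed.

(** * Growth of unipotent cocycles *)

Section unipotent.
Variables (R : realType) (d : nat).
Implicit Types A B : 'M[R]_d.

Lemma in_U1 : in_U (1%:M : 'M[R]_d).
Proof.
split=> [i|i j ji]; rewrite mxE ?eqxx //.
by case: eqVneq ji => // ->; rewrite ltnn.
Qed.

Lemma in_U_mulmx A B : in_U A -> in_U B -> in_U (A *m B).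
Proof.
move=> [A1 A0] [B1 B0]; split=> [i|i j ji]; rewrite mxE.
  rewrite (bigD1 i) //= A1 B1 mulr1 big1 ?addr0 // => l li.
  have [/A0 ->|/B0 ->|/val_inj e] := ltngtP l i; rewrite ?mul0r ?mulr0 //.
  by rewrite e eqxx in li.
rewrite big1 // => l _; case: (ltnP l i) => [/A0 ->|il]; first by rewrite mul0r.
by rewrite (B0 l j) ?mulr0 // (leq_trans ji).
Qed.

Lemma mxnatE A (i j : 'I_d) : mxnat A i j = A i j.
Proof. by rewrite /mxnat !valK. Qed.

End unipotent.

(** * Entries of the cocycle along one fixed orbit *)

Section cocycle_growth.
Variables (R : realType) (d : nat) (X : Type) (T : X -> X) (f : X -> 'M[R]_d) (x : X).
Variables (M : R) (F : nat -> R).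
Hypothesis fU : forall y, in_U (f y).
Hypothesis fM : forall y i j, `|f y i j| <= M.
Hypothesis hF : forall k, (k.+1 < d)%N ->
  arithmetic_mean (fun n => mxnat (f (iter n T x)) k k.+1) @ \oo --> F k.

Let C n := cocycle f T n x.
Let G (i j : nat) := \prod_(i <= k < j) F k.

Lemma in_U_cocycle n : in_U (C n).
Proof. by elim: n => [|n ih]; [exact: in_U1 | exact: in_U_mulmx]. Qed.

(** The unit diagonal turns the product into an increment. The superdiagonal term is set apart
    because it alone contributes to the leading order. *)
Lemma cocycle_rec n (i i1 j : 'I_d) : i1 = i.+1 :> nat ->
  C n.+1 i j - C n i j = f (iter n T x) i i1 * C n i1 j +
    \sum_(l | (l != i) && (l != i1)) f (iter n T x) i l * C n l j.
Proof.
move=> e; rewrite /C /= mxE (bigD1 i) //= (fU _).1 mul1r addrAC subrr add0r.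
by rewrite (bigD1 i1) //= -val_eqE /= e neq_ltn ltnSn orbT.
Qed.

(** Strong induction on the distance [k] to the diagonal: the entry is summed from its increments,
    which involve only entries closer to the diagonal. *)
Lemma negl_cocycle k (i j : 'I_d) : j = (i + k)%N :> nat ->
  negl k (fun n => C n i j - G i j * 'C(n, k)%:R).
Proof.
elim/ltn_ind: k i j => -[_|k ih] i j ej.
  have -> : j = i by apply: val_inj; rewrite /= ej addn0.
  rewrite (_ : (fun n => _) = fun=> 0); first exact: negl0.
  by apply/funext => n; rewrite (in_U_cocycle n).1 /G big_geq // bin0 mulr1 subrr.
have i1d : (i.+1 < d)%N by rewrite (leq_ltn_trans _ (ltn_ord j)) // ej addnS ltnS leq_addr.
pose i1 := Ordinal i1d.
have Gij : G i j = F i * G i1 j.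
  by rewrite /G /= big_ltn // ej addnS ltnS leq_addr.
pose a n := f (iter n T x) i i1.
(* Three sources of error: [e1] is inherited from the entry [(i1, j)], [e2] is the fluctuation of
   the superdiagonal entry around its Birkhoff limit, and [e3] collects the jumps over more than one
   index. *)
pose e1 n := a n * (C n i1 j - G i1 j * 'C(n, k)%:R).
pose e2 n := (a n - F i) * 'C(n, k)%:R.
pose e3 n := \sum_(l | (l != i) && (l != i1)) f (iter n T x) i l * C n l j.
(* Exact, since by Pascal's rule ['C(n, k.+1)] has increments ['C(n, k)]. At [n = 0] both terms on
   the left vanish, as [i] and [j] differ. *)
have E n : C n i j - G i j * 'C(n, k.+1)%:R =
    series e1 n + G i1 j * series e2 n + series e3 n.
  elim: n => [|n ihn].
    rewrite /series /= !big_geq // bin0n /= !mulr0 !addr0 subr0 mxE.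
    case: eqVneq => // eij; move: ej; rewrite eij => /eqP.
    by rewrite -[X in X == _]addn0 eqn_add2l.
  rewrite !seriesSr; have := cocycle_rec n j (erefl : i1 = i.+1 :> nat).
  move/eqP; rewrite subr_eq => /eqP ->.
  move/eqP: ihn; rewrite subr_eq => /eqP ->.
  by rewrite Gij binS natrD /e1 /e2 /a -/(e3 n); ring.
rewrite (funext E); apply: neglD; first apply: neglD.
- apply: negl_series; apply: (@negl_leZ _ _ M _ _ _ (ih k _ i1 j _)) => //.
    by move=> n; rewrite /e1 normrM ler_wpM2r // fM.
  by rewrite ej /= addSnnS.
- apply: neglZ; apply: negl_series_bin; apply: (@negl_series_mean _ a).
  have -> : a = (fun n => mxnat (f (iter n T x)) i i.+1).
    by apply/funext => n; rewrite /a -mxnatE.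
  exact: hF.
- apply: negl_series; apply: negl_sum => l /andP[li li1].
  (* Indices [l < i] drop out by triangularity. The others satisfy [i.+1 < l], so [C n l j] is zero
     or of order [n ^ (j - l)] with [j - l < k]. *)
  apply: (@negl_leZ _ _ M _ (fun n => if (i < l)%N then C n l j else 0)) => [n|].
    case: (ltngtP i l) => [il|il|il].
    + by rewrite normrM ler_wpM2r // fM.
    + by rewrite (fU _).2 // mul0r normr0 mulr0.
    + by move: li; rewrite -val_eqE /= il eqxx.
  case: (ltngtP i l) => [il|_|_]; [|exact: negl0|exact: negl0].
  have i1l : (i.+1 < l)%N by rewrite ltn_neqAle il andbT eq_sym; move: li1; rewrite -val_eqE.
  have [jl|lj] := ltnP j l.
    rewrite (_ : (fun n => _) = fun=> 0); first exact: negl0.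
    by apply/funext => n; rewrite (in_U_cocycle n).2.
  have ljk : (j - l < k)%N.
    by rewrite ltn_subLR // ej addnS -addSn -[X in (X < _)%N]/(i.+1 + k)%N ltn_add2r.
  have -> : (fun n => C n l j) =
      fun n => (C n l j - G l j * 'C(n, j - l)%:R) + G l j * 'C(n, j - l)%:R.
    by apply/funext => n; rewrite subrK.
  apply: neglD; last by apply: neglZ; exact: negl_bin.
  apply: (negl_weaken (ltnW ljk)); apply: ih; last by rewrite subnKC.
  exact: ltnW.
Qed.

Lemma cvg_theta_cocycle (i j : 'I_d) :
  (fun n => theta n%:R^-1 (C n) i j) @ \oo -->
  (if (i <= j)%N then (j - i)`!%:R^-1 * G i j else 0).
Proof.
case: (leqP i j) => [ij|ji]; last first.
  rewrite (_ : (fun n => _) = fun=> 0); first exact: cvg_cst.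
  by apply/funext => n; rewrite mxE leqNgt ji /= (in_U_cocycle n).2.
under eq_fun do rewrite mxE ij.
apply: cvg_unshift.
have h := negl_cocycle (esym (subnKC ij)).
have -> : (fun n => C n i j / n.+1%:R ^+ (j - i)) =
    (fun n => (C n i j - G i j * 'C(n, j - i)%:R) / n.+1%:R ^+ (j - i) +
      G i j * ('C(n, j - i)%:R / n.+1%:R ^+ (j - i))).
  by apply/funext => n; ring.
rewrite mulrC -[_ * _]add0r; apply: cvgD => //.
by apply: cvgM; [exact: cvg_cst | exact: cvg_bin].
Qed.

End cocycle_growth.

(** * Boundedness and measurability of entries with natural indices *)

Section mxnat_bounds.
Context {disp : measure_display} {X : measurableType disp} {R : realType} {d : nat}.
Variables (f : X -> 'M[R]_d) (M : R).

Lemma mxnat_cases (k l : nat) :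
  (exists i j : 'I_d, (fun y => mxnat (f y) k l) = (fun y => f y i j)) \/
  (fun y => mxnat (f y) k l) = fun=> 0.
Proof.
rewrite /mxnat; case: insubP => [i _ _|_]; last by right.
by case: insubP => [j _ _|_]; [left; exists i, j | right].
Qed.

(** The bound is [|M|] because out-of-range indices give 0, while nothing fixes the sign of [M]. *)
Lemma mxnat_norm_le k l : (forall y i j, `|f y i j| <= M) ->
  forall y, `|mxnat (f y) k l| <= `|M|.
Proof.
move=> fM y; have [[i [j e]]|e] := mxnat_cases k l; have /= -> := congr1 (@^~ y) e.
  exact: le_trans (fM y i j) (ler_norm _).
by rewrite normr0.
Qed.

Lemma measurable_mxnat k l : mx_measurable f ->
  measurable_fun setT (fun y => mxnat (f y) k l).
Proof.
by move=> mf; have [[i [j ->]]|->] := mxnat_cases k l; [exact: mf | exact: measurable_cst].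
Qed.

End mxnat_bounds.

Theorem theorem1p6 (R : realType) :
  exists lambda : nat -> R, (forall k, 0 < lambda k) /\
  forall (d : nat) (disp : measure_display) (X : measurableType disp)
    (P : probability X R) (T : X -> X) (f : X -> 'M[R]_d),
    measure_preserving P T ->
    mx_measurable f -> mx_bounded f -> (forall x, in_U (f x)) ->
    exists fstar : X -> 'M[R]_d,
      mx_measurable fstar /\ mx_bounded fstar /\ (forall x, in_U (fstar x)) /\
      {ae P, forall x, (fun n : nat => theta (n%:R^-1) (cocycle f T n x)) @ \oo --> fstar x} /\
      {ae P, forall x, fstar (T x) = fstar x} /\
      (ergodic P T ->
       {ae P, forall x, forall i j : 'I_d, (i <= j)%N ->
          fstar x i j = lambda (j - i)%N *
            \prod_(i <= k < j) Rintegral P setT (fun y => mxnat (f y) k k.+1)}).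
Proof.
exists (fun k => k`!%:R^-1); split=> [k|d disp X P T f mpT mf [M fM] fU].
  by rewrite invr_gt0 ltr0n fact_gt0.
pose phi k := fun y => mxnat (f y) k k.+1.
pose F k := birkhoff T (phi k).
have phiM k y : `|phi k y| <= `|M| by exact: (mxnat_norm_le k k.+1 fM y).
have bphi k : bdd_meas (phi k).
  by split; [exact: measurable_mxnat | exists `|M|].
have bF k : bdd_meas (F k) by exact: bdd_meas_birkhoff mpT _ (bphi k).
have FM k x : `|F k x| <= `|M| by apply: birkhoff_norm_le; exact: phiM.
(* Built from limsups, this map is bounded, invariant and in [U] at every point; only the
   convergence and the ergodic formula need an exceptional null set. *)
exists (fun x => \matrix_(i, j)
  (if (i <= j)%N then (j - i)`!%:R^-1 * \prod_(i <= k < j) F k x else 0)).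
split.
  move=> i j; case ij: (i <= j)%N; under eq_fun do rewrite mxE ij; last exact: measurable_cst.
  apply: measurable_funM; first exact: measurable_cst.
  by apply: measurable_prod => k _; exact: (bF k).1.
split.
  (* The base is at least 1, so the power [j - i] can be raised to [d] uniformly in the entry. *)
  exists ((1 + `|M|) ^+ d) => x i j; rewrite mxE; case: ifP => ij; last first.
    by rewrite normr0 exprn_ge0 // addr_ge0.
  rewrite normrM -[X in _ <= X]mul1r ler_pM //.
    rewrite ger0_norm ?invr_ge0 // invf_le1 ?ltr0n ?fact_gt0 //.
    by rewrite ler1n fact_gt0.
  rewrite normr_prod.
  apply: (@le_trans _ _ (\prod_(i <= k < j) (1 + `|M|))).
    apply: ler_prod => k _; rewrite normr_ge0 /= (le_trans (FM k x)) //.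
    by rewrite lerDr.
  rewrite prodr_const_nat ler_weXn2l ?lerDl //.
  by rewrite (leq_trans (leq_subr _ _)) // ltnW.
split.
  move=> x; split=> [i|i j ji]; rewrite mxE; last by rewrite leqNgt ji.
  by rewrite leqnn subnn fact0 invr1 big_geq // mulr1.
split.
  (* Only finitely many superdiagonal entries occur, so one null set serves for all of them. *)
  have : {ae P, forall x, forall k : 'I_d, mean T (phi k) x @ \oo --> F k x}.
    by apply: filter_forall => k; exact: birkhoff_cvg.
  apply: filterS => x hx; apply: cvg_mx_entries => i j; rewrite mxE.
  apply: (cvg_theta_cocycle (F := fun k => F k x) fU fM) => k kd.
  exact: (hx (Ordinal (ltnW kd))).
split.
  apply: aeW => x; apply/matrixP => i j; rewrite !mxE; case: ifP => // _.
  by congr (_ * _); apply: eq_bigr => k _; exact: birkhoff_invariant.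
move=> ergT.
have : {ae P, forall x, forall k : 'I_d, F k x = \int[P]_y phi k y}.
  by apply: filter_forall => k; exact: birkhoff_ergodic.
apply: filterS => x hx i j ij; rewrite mxE ij; congr (_ * _).
rewrite !big_nat; apply: eq_bigr => k /andP[_ kj].
exact: (hx (Ordinal (ltn_trans kj (ltn_ord j)))).
Qed.
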